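(* Let $B$ be the following generalized Bratteli diagram. For every $n\ge0$ the level $V_n$ consists, from left to right, of $2^n$ vertices $u^{(n)}_1,\dots,u^{(n)}_{2^n}$ followed by infinitely many vertices $c^{(n)}_1,c^{(n)}_2,c^{(n)}_3,\dots$. For every $n\ge 0$ the edges from $V_n$ to $V_{n+1}$ are the following: each vertex $u^{(n+1)}_{2j-1}$ and $u^{(n+1)}_{2j}$ ($1\le j\le 2^n$) has exactly two incoming edges, one from $u^{(n)}_j$ and one from $c^{(n)}_1$; the vertex $c^{(n+1)}_1$ has exactly three incoming edges, two from $c^{(n)}_1$ and one from $c^{(n)}_2$; for $k\ge2$ the vertex $c^{(n+1)}_k$ has exactly four incoming edges, one from $c^{(n)}_{k-1}$, two from $c^{(n)}_k$ and one from $c^{(n)}_{k+1}$. Equip $B$ with the left-to-right ordering. Then: (1) The set $X_{max}$ of infinite maximal paths is empty. (2) The Vershik map $\varphi_B:X_B\to X_B\setminus X_{min}$ is a homeomorphism. (3) There exists a non-empty clopen set $C\subset X_B$ such that its tail equivalence class $\mathcal R(C)$ is compressible. (4) There is no probability $\varphi_B$-invariant measure on $X_B$ that assigns positive values to all cylinder sets.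
   Context: The path space $X_B$ is the set of infinite paths $x=(x_i)_{i\ge0}$, where $x_i$ is an edge from $V_i$ to $V_{i+1}$ and $r(x_i)=s(x_{i+1})$ ($s,r$ are the source and range of an edge), with the topology generated by the cylinder sets $[\overline e]=\{x: x_0=e_0,\dots,x_n=e_n\}$. Left-to-right ordering: each finite set $r^{-1}(v)$, $v\in V_n$, $n\ge1$, is linearly ordered so that $e<f$ whenever $s(e)$ lies to the left of $s(f)$ (parallel edges are ordered arbitrarily). A (finite or infinite) path is maximal (minimal) if each of its edges $e_i$ is maximal (minimal) in $r^{-1}(r(e_i))$; $X_{max}$, $X_{min}$ are the sets of infinite maximal, minimal paths. The map $\varphi_B:X_B\setminus X_{max}\to X_B\setminus X_{min}$ sends $x=(x_0,x_1,\dots)$ to $(g_0,\dots,g_{m-1},g_m,x_{m+1},\dots)$, where $m$ is the least index with $x_m$ not maximal, $g_m$ is the successor of $x_m$ in $r^{-1}(r(x_m))$ and $(g_0,\dots,g_{m-1})$ is the minimal path from $V_0$ to $s(g_m)$. A Borel measure $\mu$ is $\varphi_B$-invariant if $\mu(\varphi_B^{-1}(A))=\mu(A)$ for every Borel set $A\subset X_B$. $\mathcal R$ is the tail equivalence relation: $(x,y)\in\mathcal R$ iff $x_i=y_i$ for all sufficiently large $i$. $\mathcal R(C)$ is the set of all points $\mathcal R$-equivalent to some point of $C$. A countable Borel equivalence relation $\mathcal E$ on $X$ is compressible if there is an injective Borel map $f:X\to X$ such that $f(L)\subsetneq L$ for every $\mathcal E$-class $L$; a Borel set $A$ is compressible if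 the restriction of the relation (here $\mathcal R$) to $A$ is compressible. *)

(* Defs.v *)
From HB Require Import structures.
From mathcomp Require Import all_boot all_order all_algebra.
From mathcomp Require Import all_classical all_reals all_analysis.

Set Implicit Arguments.
Unset Strict Implicit.
Unset Printing Implicit Defensive.

Import Order.TTheory GRing.Theory Num.Theory.
Local Open Scope classical_set_scope.

(* [edge n] is the set of edges from level [n] to level [n.+1]. *)
Record bratteli := Bratteli {
  vertex : nat -> countType;
  edge : nat -> countType;
  src : forall n, edge n -> vertex n;
  tgt : forall n, edge n -> vertex n.+1;
  vertex_infinite : forall n, infinite_set [set: vertex n];
  src_surj : forall n (v : vertex n), exists e, src e = v;
  tgt_surj : forall n (v : vertex n.+1), exists e, tgt e = v;
  tgt_finite : forall n (v : vertex n.+1), finite_set [set e | tgt e = v] }.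

Arguments src {b n} e.
Arguments tgt {b n} e.

Record path_space (B : bratteli) := PathSpace {
  path_edge :> forall n, edge B n;
  path_edgeP : forall n, tgt (path_edge n) = src (path_edge n.+1) }.

(* A finite path (e_0, ..., e_n); the proofs of [i <= n] are irrelevant,
   [<=] being boolean. *)
Record fin_path (B : bratteli) (n : nat) := FinPath {
  fin_edge :> forall i, (i <= n)%N -> edge B i;
  fin_edgeP : forall i (hi : (i < n)%N),
    tgt (fin_edge (ltnW hi)) = src (fin_edge hi) }.

Definition cylinder (B : bratteli) (n : nat) (e : fin_path B n) :
  set (path_space B) := [set x | forall i (hi : (i <= n)%N), x i = e i hi].

Definition is_cylinder (B : bratteli) : set (set (path_space B)) :=
  [set C | exists n (e : fin_path B n), C = cylinder e].

Arguments is_cylinder B : clear implicits.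

HB.instance Definition _ (B : bratteli) := gen_eqMixin (path_space B).
HB.instance Definition _ (B : bratteli) := gen_choiceMixin (path_space B).

Section PathSpaceInstances.
Variable B : bratteli.

Lemma path_space_inhabited : exists _ : path_space B, True.
Proof.
have [v0 _] := infinite_setN0 (@vertex_infinite B 0).
pose out n (v : vertex B n) := projT1 (cid (src_surj v)).
have outP n (v : vertex B n) : src (out n v) = v.
  by rewrite /out; case: cid.
pose vs := fix vs n : vertex B n :=
  if n is m.+1 then tgt (out m (vs m)) else v0.
have h n : tgt (out n (vs n)) = src (out n.+1 (vs n.+1)) by rewrite outP.
by exists (@PathSpace B (fun n => out n (vs n)) h).
Qed.

HB.instance Definition _ :=
  isPointed.Build (path_space B) (projT1 (cid path_space_inhabited)).

Definition path_prefix (x : path_space B) n : fin_path B n :=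
  @FinPath B n (fun i _ => x i) (fun i _ => path_edgeP x i).

Lemma cylinder_cover : \bigcup_(C in is_cylinder B) id C = setT.
Proof.
apply/seteqP; split => // x _.
exists (cylinder (path_prefix x 0)) => //.
by exists 0%N, (path_prefix x 0).
Qed.

Lemma cylinder_join (C D : set (path_space B)) (x : path_space B) :
    is_cylinder B C -> is_cylinder B D -> id C x -> id D x ->
  exists K, [/\ is_cylinder B K, id K x & id K `<=` id C `&` id D].
Proof.
move=> [n [e ->]] [m [f ->]] /= xe xf.
exists (cylinder (path_prefix x (maxn n m))); split => //.
  by exists (maxn n m), (path_prefix x (maxn n m)).
move=> y /= xy; split => i hi.
- by rewrite xy ?leq_max ?hi//= xe.
- by rewrite xy ?leq_max ?hi ?orbT//= xf.
Qed.

HB.instance Definition _ := isBaseTopological.Build (path_space B)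
  cylinder_cover cylinder_join.

End PathSpaceInstances.

Definition borel (X : ptopologicalType) := g_sigma_algebraType (@open X).

(* Only the restriction of [elt] to each fibre of [tgt] is constrained, and
   only that restriction is ever used. *)
Record edge_order (B : bratteli) := EdgeOrder {
  elt : forall n, rel (edge B n);
  elt_irr : forall n (e : edge B n), ~~ elt e e;
  elt_trans : forall n (e f g : edge B n), tgt e = tgt f -> tgt f = tgt g ->
    elt e f -> elt f g -> elt e g;
  elt_total : forall n (e f : edge B n), tgt e = tgt f -> e != f ->
    elt e f || elt f e }.

Arguments elt {B} o {n} : rename.

Definition left_to_right (B : bratteli) (o : edge_order B)
    (left : forall n, rel (vertex B n)) : Prop :=
  forall n (e f : edge B n), tgt e = tgt f -> left n (src e) (src f) ->
    elt o e f.

Section Vershik.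
Variables (B : bratteli) (o : edge_order B).

Definition max_edge n (e : edge B n) : Prop :=
  forall f, tgt f = tgt e -> ~~ elt o e f.

Definition min_edge n (e : edge B n) : Prop :=
  forall f, tgt f = tgt e -> ~~ elt o f e.

Definition succ_edge n (e g : edge B n) : Prop :=
  [/\ tgt g = tgt e, elt o e g &
      forall f, tgt f = tgt e -> elt o e f -> ~~ elt o f g].

Definition X_max : set (path_space B) := [set x | forall n, max_edge (x n)].

Definition X_min : set (path_space B) := [set x | forall n, min_edge (x n)].

Definition vershik_spec (x y : path_space B) : Prop :=
  exists m, [/\ forall i, (i < m)%N -> max_edge (x i),
                ~ max_edge (x m),
                forall i, (i < m)%N -> min_edge (y i),
                succ_edge (x m) (y m) &
                forall i, (m < i)%N -> y i = x i].

(* The Vershik map has domain [~` X_max]; on [X_max] this function is the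
   identity, a value that is never meant to be used. *)
Definition vershik (x : path_space B) : path_space B :=
  xget x [set y | vershik_spec x y].

Definition vershik_invariant (R : realType)
    (mu : set (borel (path_space B)) -> \bar R) : Prop :=
  forall A : set (borel (path_space B)), measurable A ->
    mu (~` X_max `&` vershik @^-1` A) = mu A.

End Vershik.

Definition tail_equiv (B : bratteli) (x y : path_space B) : Prop :=
  exists N, forall i, (N <= i)%N -> x i = y i.

Arguments tail_equiv B : clear implicits.

Definition saturation (X : Type) (E : X -> X -> Prop) (C : set X) : set X :=
  [set x | exists2 y, C y & E y x].

(* Compressibility of the restriction of [E] to the Borel set [A]; the classes
   of this restriction are the sets [A `&` E x] with [x] in [A], and only the
   values of [f] on [A] matter. *)
Definition compressible (X : ptopologicalType) (E : X -> X -> Prop)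
    (A : set X) : Prop :=
  measurable (A : set (borel X)) /\ exists f : borel X -> borel X,
    [/\ measurable_fun (A : set (borel X)) f, set_inj A f &
        forall x, A x -> f @` (A `&` E x) `<` A `&` E x].

Definition homeomorphism (X Y : topologicalType) (A : set X) (B : set Y)
    (f : X -> Y) : Prop :=
  [/\ set_bij A B f, {within A, continuous f} &
      exists2 g : Y -> X, {within B, continuous g} & {in A, cancel f g}].

(* With indices starting from 0: [inl j] is u_{j+1} and [inr k] is c_{k+1}. *)
Definition tree_vertex (n : nat) : countType := ('I_(2 ^ n) + nat)%type.

Definition tree_left (n : nat) : rel (tree_vertex n) := fun v w =>
  match v, w with
  | inl i, inl j => (i < j)%N
  | inl _, inr _ => true
  | inr _, inl _ => false
  | inr k, inr l => (k < l)%N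
  end.

(* Number of edges from [v] to [w]; the 0-based children of j are 2j, 2j+1. *)
Definition tree_mult (n : nat) (v : tree_vertex n) (w : tree_vertex n.+1) :
    nat :=
  match v, w with
  | inl j, inl i => if (i : nat)./2 == j then 1 else 0
  | inr l, inl _ => if l == 0%N then 1 else 0
  | inl _, inr _ => 0
  | inr l, inr k =>
      if l == k then 2 else if (l.+1 == k) || (l == k.+1) then 1 else 0
  end.

Definition tree_edge (n : nat) : countType :=
  {vw : tree_vertex n * tree_vertex n.+1 & 'I_(tree_mult vw.1 vw.2)}.

Definition tree_src n (e : tree_edge n) : tree_vertex n := (tag e).1.

Definition tree_tgt n (e : tree_edge n) : tree_vertex n.+1 := (tag e).2.

Lemma tree_edge_ex n (v : tree_vertex n) (w : tree_vertex n.+1) :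
  (0 < tree_mult v w)%N -> exists e, tree_src e = v /\ tree_tgt e = w.
Proof.
move=> h; exists (existT (fun vw : tree_vertex n * tree_vertex n.+1 =>
  'I_(tree_mult vw.1 vw.2)) (v, w) (Ordinal h)); by split.
Qed.

Lemma tree_vertex_infinite n : infinite_set [set: tree_vertex n].
Proof.
move=> fin; apply: infinite_nat.
rewrite -(preimage_setT (fun k : nat => inr k : tree_vertex n)).
by apply: finite_preimage fin => k l _ _ [].
Qed.

Lemma tree_src_surj n (v : tree_vertex n) : exists e, tree_src e = v.
Proof.
case: v => [j|l].
  have hj : (j.*2 < 2 ^ n.+1)%N by rewrite expnS mul2n ltn_double.
  have [|e [ev _]] := @tree_edge_ex n (inl j) (inl (Ordinal hj)).
    by rewrite /= doubleK eqxx.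
  by exists e.
have [|e [ev _]] := @tree_edge_ex n (inr l) (inr l); last by exists e.
by rewrite /= eqxx.
Qed.

Lemma tree_tgt_surj n (w : tree_vertex n.+1) : exists e, tree_tgt e = w.
Proof.
case: w => [i|k].
  by have [|e [_ ew]] := @tree_edge_ex n (inr 0%N) (inl i); last by exists e.
have [|e [_ ew]] := @tree_edge_ex n (inr k) (inr k); last by exists e.
by rewrite /= eqxx.
Qed.

Lemma tree_tgt_finite n (w : tree_vertex n.+1) :
  finite_set [set e | tree_tgt e = w].
Proof.
pose K := if w is inr k then k.+2 else 1%N.
pose code (v : 'I_(2 ^ n) + 'I_K) : tree_vertex n :=
  match v with inl j => inl j | inr l => inr (val l) end.
pose T := {v : 'I_(2 ^ n) + 'I_K & 'I_(tree_mult (code v) w)}.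
pose F (t : T) : tree_edge n :=
  existT (fun vw : tree_vertex n * tree_vertex n.+1 =>
    'I_(tree_mult vw.1 vw.2)) (code (tag t), w) (tagged t).
apply: (@sub_finite_set _ _ (F @` setT)); last first.
  exact/finite_image/finite_finset.
move=> [[v w'] m] /=; rewrite /tree_tgt /= => ew; subst w'.
case: v m => [j|l] /= m.
  by exists (existT _ (inl j) m).
have hl : (l < K)%N.
  rewrite /K; case: w {K code T F} m => [i|k].
    by rewrite /=; case: eqP => [-> //|_ []].
  rewrite /=; case: eqP => [-> //|_].
  by case: orP => [[/eqP <-|/eqP ->]|_ []] => // _; rewrite ltnW.
by exists (existT _ (inr (Ordinal hl)) m).
Qed.

Definition tree_bratteli : bratteli :=
  @Bratteli tree_vertex tree_edge tree_src tree_tgt tree_vertex_infinite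
    tree_src_surj tree_tgt_surj tree_tgt_finite.

(* Main.v *)
Require Import Defs.
From mathcomp Require Import all_boot all_order all_algebra.
From mathcomp Require Import all_classical all_reals all_analysis.

(** Write u for the finite binary part of the diagram and c for the infinite
    part on its right.  Everything follows from two facts about the order.

    An edge that is maximal leaves c, and an edge from c_k to c_l is maximal
    only if k = l + 1, because c_l has an edge from its right neighbour.  A
    maximal infinite path would therefore be an infinite descent along the
    indices of c, so X_max is empty ([tree_X_max]).  That the Vershik map is
    then a homeomorphism onto the complement of X_min is a general fact about
    ordered diagrams: the map changes only an initial segment of the path,
    whose length is locally constant, and reversing the order of the edges
    exchanges X_max and X_min and inverts the map ([vershik_homeomorphism]).

    On the other side, a path that visits u never leaves it, and an edge
    between vertices of u is minimal, being the leftmost of two.  Hence the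
    clopen set C of the paths that start in u consists of minimal paths
    ([u_path_X_min]).  The Vershik map is defined everywhere, is injective,
    respects tail equivalence, and misses the point of C that lies in each
    tail class of R(C); thus it compresses R(C) itself
    ([vershik_compressible]).  For the same reason an invariant measure gives
    C the mass of its empty preimage ([invariant_X_min]), although C contains
    a cylinder. *)

Set Implicit Arguments.
Unset Strict Implicit.
Unset Printing Implicit Defensive.

Local Open Scope classical_set_scope.
Local Open Scope ring_scope.

(** * Infinite paths *)

Section Paths.
Variable B : bratteli.
Implicit Types x y z : path_space B.

Lemma path_ext x y : (forall i, x i = y i) -> x = y.
Proof.
case: x y => [f hf] [g hg] /= fg.
have E : f = g by apply: functional_extensionality_dep.
by subst g; congr PathSpace; apply: Prop_irrelevance.
Qed.

(** Cutting a path after its edge [x m] and prepending another finite path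
    with the same range is the only way in which new paths are produced. *)
Lemma splice (p : forall i, edge B i) x m :
  (forall i, (i < m)%N -> tgt (p i) = src (p i.+1)) -> tgt (p m) = tgt (x m) ->
  exists y, (forall i, (i <= m)%N -> y i = p i) /\
            (forall i, (m < i)%N -> y i = x i).
Proof.
move=> pP pm.
pose f i := if (i <= m)%N then p i else x i.
have fP i : tgt (f i) = src (f i.+1).
  rewrite /f; case: (ltngtP i m) => [im|//|->]; first exact: pP.
    by move=> mi; exact: path_edgeP.
  by rewrite pm path_edgeP.
exists (PathSpace fP); split=> i h /=; rewrite /f ?h //.
by rewrite leqNgt h.
Qed.

Lemma path_from (v : vertex B 0) : exists x, src (x 0%N) = v.
Proof.
pose out n (w : vertex B n) := projT1 (cid (src_surj w)).
have outP n (w : vertex B n) : src (out n w) = w by rewrite /out; case: cid.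
pose vs := fix vs n : vertex B n :=
  if n is m.+1 then tgt (out m (vs m)) else v.
have h n : tgt (out n (vs n)) = src (out n.+1 (vs n.+1)) by rewrite outP.
by exists (PathSpace h); apply: outP.
Qed.

Lemma nbhs_path x (U : set (path_space B)) :
  nbhs x U <-> exists n, forall y, (forall i, (i <= n)%N -> y i = x i) -> U y.
Proof.
rewrite nbhsE; split.
  move=> [V [[D DB <-] [C DC Cx]] VU].
  have [n [e Ce]] := DB _ DC.
  exists n => y yx; apply: VU; exists C => //; rewrite Ce => i hi.
  by rewrite yx //; move: Cx; rewrite Ce; apply.
move=> [n nU]; exists (cylinder (path_prefix x n)) => //.
split; last by [].
exists [set cylinder (path_prefix x n)]; last by rewrite bigcup_set1.
by move=> _ ->; exists n, (path_prefix x n).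
Qed.

Lemma open_path (U : set (path_space B)) :
  open U <-> forall x, U x ->
    exists n, forall y, (forall i, (i <= n)%N -> y i = x i) -> U y.
Proof.
rewrite openE; split=> h x /h; first by move/nbhs_path.
by move=> hx; apply/nbhs_path.
Qed.

Lemma open_first_edge (P : pred (edge B 0)) :
  open [set x : path_space B | P (x 0%N)].
Proof. by apply/open_path => x Px; exists 0%N => y yx /=; rewrite yx. Qed.

Lemma clopen_first_edge (P : pred (edge B 0)) :
  clopen [set x : path_space B | P (x 0%N)].
Proof.
split; first exact: open_first_edge.
rewrite -openC (_ : ~` _ = [set x : path_space B | predC P (x 0%N)]).
  exact: open_first_edge.
by apply/seteqP; split=> x /negP.
Qed.

Lemma cylinder_measurable n (e : fin_path B n) :
  measurable (cylinder e : set (borel (path_space B))).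
Proof.
apply: sub_sigma_algebra; apply/open_path => x xe.
by exists n => y yx i hi; rewrite yx.
Qed.

(** * Tail equivalence *)

Lemma tail_equiv_sym x y : tail_equiv B x y -> tail_equiv B y x.
Proof. by move=> [N h]; exists N => i /h. Qed.

Lemma tail_equiv_trans x y z :
  tail_equiv B x y -> tail_equiv B y z -> tail_equiv B x z.
Proof.
move=> [M h] [N k]; exists (maxn M N) => i.
by rewrite geq_max => /andP[/h -> /k].
Qed.

Lemma tail_saturation_closed (C : set (path_space B)) x y :
  saturation (tail_equiv B) C x -> tail_equiv B x y ->
  saturation (tail_equiv B) C y.
Proof. by move=> [z Cz zx] xy; exists z => //; exact: tail_equiv_trans xy. Qed.

(** If [y] in [C] has the same tail as [x], a path [z] close to [x] has the same
    tail as [y] with its tail replaced by that of [z], and this path is close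
    to [y]. *)
Lemma open_tail_saturation (C : set (path_space B)) :
  open C -> open (saturation (tail_equiv B) C).
Proof.
move=> /open_path oC; apply/open_path => x [y Cy [N yx]].
have [M nC] := oC _ Cy.
exists (maxn M N) => z zx.
have [|w [wy wz]] := @splice y z (maxn M N) (fun i _ => path_edgeP y i).
  by rewrite zx // yx // leq_maxr.
exists w; first by apply: nC => i iM; rewrite wy // leq_max iM.
by exists (maxn M N).+1.
Qed.

End Paths.

(** * Extremal edges *)

Section Order.
Variable B : bratteli.

Definition rev_order (o : edge_order B) : edge_order B.
Proof.
apply: (@EdgeOrder B (fun n e f => elt o f e)).
- by move=> n e; apply: elt_irr.
- by move=> n e f g ef fg fe gf; apply: elt_trans gf fe; rewrite -?fg.
- by move=> n e f ef nef; rewrite orbC; apply: elt_total.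
Defined.

Variable o : edge_order B.

Lemma fibre_min n (v : vertex B n.+1) (P : set (edge B n)) :
  P `<=` [set e | tgt e = v] -> P !=set0 ->
  exists2 e, P e & forall f, P f -> ~~ elt o f e.
Proof.
move=> Pv P0.
have /finite_seqP[s Ps] : finite_set P by apply: sub_finite_set (tgt_finite v).
move: P0 Pv; rewrite {}Ps => -[e0 /= e0s] sv.
suff [e es emin] : exists2 e, e \in s & forall f, f \in s -> ~~ elt o f e.
  by exists e.
elim: s e0 e0s sv => [//|a s IH] _ _ sv.
case: s IH sv => [_ _|b s IH sv].
  by exists a; rewrite ?mem_head // => f; rewrite inE => /eqP ->;
    exact: elt_irr.
have [f fs|e es emin] := IH b (mem_head _ _).
  by apply: sv; rewrite /= inE (fs : f \in _) orbT.
have tE f : f \in a :: b :: s -> tgt f = v by apply: sv.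
have eas : e \in a :: b :: s by rewrite inE es orbT.
have [ae|nae] := boolP (elt o a e).
  exists a; first exact: mem_head.
  move=> f; rewrite inE => /orP[/eqP ->|fs]; first exact: elt_irr.
  have fas : f \in a :: b :: s by rewrite inE fs orbT.
  apply: contra (emin _ fs) => fa.
  by apply: elt_trans fa ae; rewrite !tE ?mem_head.
exists e => // f; rewrite inE => /orP[/eqP -> //|]; exact: emin.
Qed.

Lemma min_edge_ex n (v : vertex B n.+1) : exists2 e, tgt e = v & min_edge o e.
Proof.
have [e ev emin] := @fibre_min n v _ (@subset_refl _ _) (tgt_surj v).
by exists e => // f fe; apply: emin; rewrite /= fe.
Qed.

Lemma min_edge_inj n (e f : edge B n) :
  tgt e = tgt f -> min_edge o e -> min_edge o f -> e = f.
Proof.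
move=> ef emin fmin; apply/eqP; apply: contraT => nef.
by case/orP: (elt_total o ef nef); apply: contraTT; rewrite ?fmin ?emin.
Qed.

Lemma succ_edge_ex n (e : edge B n) :
  ~ max_edge o e -> exists g, succ_edge o e g.
Proof.
move=> nmax.
have [||g [ge eg] gmin] :=
  @fibre_min n (tgt e) [set f | tgt f = tgt e /\ elt o e f].
- by move=> f [].
- apply: contrapT => h; apply: nmax => f fe.
  by apply/negP => ef; apply: h; exists f.
by exists g; split=> // f fe ef; apply: gmin.
Qed.

Lemma succ_edge_inj n (e g h : edge B n) :
  succ_edge o e g -> succ_edge o e h -> g = h.
Proof.
move=> [ge eg gmin] [he eh hmin]; apply/eqP; apply: contraT => ngh.
case/orP: (@elt_total _ o _ g h (etrans ge (esym he)) ngh);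
  apply: contraTT => _.
  exact: hmin.
exact: gmin.
Qed.

(** Choosing minimal edges backwards from [g]; the values beyond index [m] are
    junk. *)
Lemma min_prefix m (g : edge B m) : exists p : forall i, edge B i,
  [/\ p m = g, forall i, (i < m)%N -> tgt (p i) = src (p i.+1) &
      forall i, (i < m)%N -> min_edge o (p i)].
Proof.
elim: m g => [|m IH] g.
  exists (dfwith (point : path_space B) 0 g); split=> //; exact: dfwithin.
have [e eg emin] := min_edge_ex (src g).
have [p [pm pP pmin]] := IH e.
have pE i : (i < m.+1)%N -> dfwith p m.+1 g i = p i.
  by move=> im; apply: dfwithout; rewrite eq_sym neq_ltn im.
exists (dfwith p m.+1 g); split; first exact: dfwithin.
  move=> i; rewrite ltnS leq_eqVlt => /orP[/eqP ->|im].
    by rewrite dfwithin pE // pm.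
  by rewrite !pE // ?pP // ltnW.
move=> i im; rewrite pE //; move: im; rewrite ltnS leq_eqVlt.
by move=> /orP[/eqP ->|/pmin //]; rewrite pm.
Qed.

End Order.

(** * The Vershik map *)

Section VershikMap.
Variables (B : bratteli) (o : edge_order B).
Implicit Types x y z : path_space B.

Lemma vershik_spec_uniq x y z :
  vershik_spec o x y -> vershik_spec o x z -> y = z.
Proof.
move=> [m [xmax xm ymin ys yx]] [n [xmax' xn zmin zs zx]].
have nm : n = m.
  by case: (ltngtP n m) => // [/xmax//|/xmax'//].
subst n.
have yzm : y m = z m by exact: succ_edge_inj ys zs.
have below k : (k <= m)%N -> y (m - k)%N = z (m - k)%N.
  elim: k => [_|k IH km]; first by rewrite subn0.
  have km' : (m - k.+1 < m)%N by rewrite ltn_subrL (leq_trans _ km).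
  apply: (@min_edge_inj _ o); [|exact: ymin|exact: zmin].
  by rewrite !path_edgeP subnSK // IH // ltnW.
apply: path_ext => i; case: (leqP i m) => im; last by rewrite yx // zx.
by rewrite -(subKn im) below // leq_subr.
Qed.

Lemma vershikP x : ~ X_max o x -> vershik_spec o x (vershik o x).
Proof.
move=> nx; apply: (@xgetPex _ x [set y | vershik_spec o x y]).
have ex : exists n, `[< ~ max_edge o (x n) >].
  apply: contrapT => h; apply: nx => n; apply: contrapT => hn.
  by apply: h; exists n; apply/asboolP.
have [m /asboolP xm mleast] := ex_minnP ex.
have [g [gx xg gmin]] := succ_edge_ex xm.
have [p [pm pP pmin]] := min_prefix o g.
have [|y [yp yx]] := splice (x := x) pP; first by rewrite pm gx.
exists y, m; split=> //.
- move=> i im; apply: contrapT => /asboolP /mleast.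
  by rewrite leqNgt im.
- by move=> i im; rewrite yp; [exact: pmin | exact: ltnW].
- by rewrite yp // pm.
Qed.

Lemma vershik_X_min x : ~ X_max o x -> ~ X_min o (vershik o x).
Proof.
move=> /vershikP[m [_ _ _ [yx xy _] _]] ymin.
by move: (ymin m _ (esym yx)); rewrite xy.
Qed.

Lemma vershik_tail x : ~ X_max o x -> tail_equiv B x (vershik o x).
Proof. by move=> /vershikP[m [_ _ _ _ yx]]; exists m.+1 => i /yx. Qed.

(** A path that agrees with [x] beyond the first non-maximal edge of [x] is
    moved in the same way as [x]. *)
Lemma vershik_continuous x : ~ X_max o x ->
  {for x, continuous (vershik o)}.
Proof.
move=> nx U /nbhs_path[n nU]; apply/nbhs_path.
have [m [xmax xm ymin ys yx]] := vershikP nx.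
exists (maxn n m) => z zx; apply: nU => i im.
have zxm j : (j <= m)%N -> z j = x j.
  by move=> jm; rewrite zx // leq_max jm orbT.
have [|w [wy wz]] :=
  @splice B (vershik o x) z m (fun i _ => path_edgeP (vershik o x) i).
  by case: ys => -> _ _; rewrite zxm.
have zw : vershik_spec o z w.
  exists m; rewrite zxm // wy //; split=> // j jm.
    by rewrite zxm; [exact: xmax | exact: ltnW].
  by rewrite wy; [exact: ymin | exact: ltnW].
have nz : ~ X_max o z by move=> zmax; apply: xm; rewrite -zxm.
rewrite (vershik_spec_uniq (vershikP nz) zw).
case: (leqP i m) => [/wy //|mi].
by rewrite wz // zx ?leq_max ?im // yx.
Qed.

End VershikMap.

Section Homeomorphism.
Variables (B : bratteli) (o : edge_order B).
Implicit Types x y z : path_space B.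

Lemma vershik_spec_rev x y :
  vershik_spec o x y <-> vershik_spec (rev_order o) y x.
Proof.
split=> -[m [xmax xm ymin [yx xy xymin] tl]]; exists m; split=> //.
- by move=> h; move: (h _ (esym yx)); rewrite /= xy.
- split=> // f fy; apply: contraL => xf; apply: xymin => //.
  by rewrite fy.
- by move=> i /tl.
- by move=> h; move: (h _ (esym yx)); move: xy => /= ->.
- split=> // f fx; apply: contraL => xf; apply: xymin => //.
  by rewrite fx.
- by move=> i /tl.
Qed.

Lemma vershik_revK x : ~ X_max o x -> vershik (rev_order o) (vershik o x) = x.
Proof.
move=> nx; have nmin := vershik_X_min nx.
apply: (@vershik_spec_uniq _ (rev_order o) (vershik o x)).
  exact: vershikP.
by apply/vershik_spec_rev; exact: vershikP.
Qed.

Lemma vershikK_rev y : ~ X_min o y ->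
  ~ X_max o (vershik (rev_order o) y) /\
  vershik o (vershik (rev_order o) y) = y.
Proof.
move=> ny.
have yP : vershik_spec (rev_order o) y (vershik (rev_order o) y).
  exact: vershikP.
move/vershik_spec_rev: yP => yP.
have nx : ~ X_max o (vershik (rev_order o) y).
  by case: yP => m [_ xm _ _ _] /(_ m).
by split=> //; exact: vershik_spec_uniq (vershikP nx) yP.
Qed.

Lemma vershik_inj : set_inj (~` X_max o) (vershik o).
Proof.
move=> x y /set_mem nx /set_mem ny xy.
by rewrite -(vershik_revK nx) xy vershik_revK.
Qed.

Lemma vershik_homeomorphism :
  homeomorphism (~` X_max o) (~` X_min o) (vershik o).
Proof.
split.
- split; [|exact: vershik_inj|].
    by move=> x; exact: vershik_X_min.
  by move=> y /vershikK_rev[nx <-]; exists (vershik (rev_order o) y).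
- by apply: continuous_in_subspaceT => x /set_mem; exact: vershik_continuous.
exists (vershik (rev_order o)); last by move=> x /set_mem; exact: vershik_revK.
apply: continuous_in_subspaceT => x /set_mem ny.
exact: (@vershik_continuous B (rev_order o)).
Qed.

End Homeomorphism.

(** * Consequences for compressibility and invariant measures *)

Lemma continuous_borel_measurable (X Y : ptopologicalType) (f : X -> Y)
    (A : set X) :
  continuous f -> measurable (A : set (borel X)) ->
  measurable_fun (A : set (borel X)) (f : borel X -> borel Y).
Proof.
move=> /continuousP cf mA; apply: measurability => //.
move=> _ [U oU <-]; apply: measurableI => //.
by apply: sub_sigma_algebra; exact: cf.
Qed.

Section Consequences.
Variables (B : bratteli) (o : edge_order B).

(** The Vershik map pushes every tail class into itself and always misses the
    minimal points, so a tail class that contains a minimal point is mapped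
    onto a proper part of itself. *)
Lemma vershik_compressible (C : set (path_space B)) :
  X_max o = set0 -> open C -> C `<=` X_min o ->
  compressible (tail_equiv B) (saturation (tail_equiv B) C).
Proof.
move=> max0 oC Cmin.
have nmax x : ~ X_max o x by rewrite max0.
have mA : measurable
    (saturation (tail_equiv B) C : set (borel (path_space B))).
  by apply: sub_sigma_algebra; exact: open_tail_saturation.
split=> //; exists (vershik o); split.
- apply: continuous_borel_measurable => // x; exact: vershik_continuous.
- by move=> x y _ _; apply: vershik_inj; exact/mem_set/nmax.
move=> x Ax; split.
  move=> _ [y [Ay xy] <-]; have yy := vershik_tail (nmax y).
  split; first exact: tail_saturation_closed yy.
  exact: tail_equiv_trans yy.
have [z Cz zx] := Ax.
case/(_ z) => [|y _ yz].
  by split; [exists z => //; exists 0%N | exact: tail_equiv_sym].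
by apply: (vershik_X_min (nmax y)); rewrite yz; exact: Cmin.
Qed.

(** The preimage of a set of minimal paths under the Vershik map is empty. *)
Lemma invariant_X_min (R : realType)
    (mu : {measure set (borel (path_space B)) -> \bar R})
    (D : set (borel (path_space B))) :
  vershik_invariant o mu -> measurable D -> D `<=` X_min o ->
  mu D = 0%E.
Proof.
move=> inv mD Dmin; rewrite -inv // (_ : _ `&` _ = set0) ?measure0 //.
by apply/seteqP; split=> x // [nx /Dmin /(vershik_X_min nx)].
Qed.

End Consequences.

(** * The diagram *)

Definition is_u n (v : tree_vertex n) : bool :=
  if v is inl _ then true else false.

Section Tree.
Variables (o : edge_order tree_bratteli) (ho : left_to_right o tree_left).

Lemma tree_mult_gt0 n (e : edge tree_bratteli n) :
  (0 < tree_mult (tree_src e) (tree_tgt e))%N.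
Proof. by case: e => [[v w] /= a]; case: (tree_mult v w) a => // -[]. Qed.

(** The right neighbour of a vertex of c is a source of an edge into it, and
    c_1 is a source of an edge into every vertex of u. *)
Lemma max_edge_c n (e : edge tree_bratteli n) : max_edge o e ->
  exists2 k, tree_src e = inr k & forall l, tree_tgt e = inr l -> k = l.+1.
Proof.
move=> emax; have := tree_mult_gt0 e.
have nlt v : (0 < tree_mult v (tree_tgt e))%N -> ~~ tree_left (tree_src e) v.
  move=> /tree_edge_ex[f [fv fe]]; apply: contra (emax f fe) => ev.
  by apply: ho => //; rewrite /= fv.
case se : (tree_src e) nlt => [j|k]; case te : (tree_tgt e) => [i|l] //= nlt.
- by have := nlt (inr 0%N) isT.
- by exists k.
case: eqP => [kl _|_].
  have := nlt (inr l.+1); rewrite /= kl ltnSn eqxx orbT gtn_eqF //.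
  by move=> /(_ isT).
case: eqP => [kl _|_ /=].
  have := nlt (inr l.+1); rewrite /= -kl (ltn_trans (ltnSn k)) //.
  by rewrite eqxx orbT gtn_eqF // => /(_ isT).
case: eqP => // -> _; exists l.+1 => // _ [<-] //.
Qed.

Lemma tree_X_max : X_max o = set0.
Proof.
apply/seteqP; split=> // x xmax.
have nc k n : tree_src (x n) <> inr k.
  elim: k n => [|k IH] n xn; have [l] := max_edge_c (xmax n).
    rewrite xn => -[<-]; have [l' xn' _] := max_edge_c (xmax n.+1).
    by rewrite (path_edgeP x n : tree_tgt _ = tree_src _) => /(_ _ xn').
  rewrite xn => -[<-]; have [l' xn' _] := max_edge_c (xmax n.+1).
  rewrite (path_edgeP x n : tree_tgt _ = tree_src _) => /(_ _ xn') [kl].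
  by apply: (IH n.+1); rewrite xn' kl.
by have [k /nc] := max_edge_c (xmax 0%N).
Qed.

Lemma u_edge_tgt n (e : edge tree_bratteli n) :
  is_u (tree_src e) -> is_u (tree_tgt e).
Proof.
by have := tree_mult_gt0 e; case: (tree_src e) => // j; case: (tree_tgt e).
Qed.

Lemma u_edge_inj n (e f : edge tree_bratteli n) :
  is_u (tree_src e) -> is_u (tree_src f) -> tree_tgt e = tree_tgt f -> e = f.
Proof.
move=> ue uf; have := u_edge_tgt ue.
case: e f ue uf => [[v w] a] [[v' w'] b]; rewrite /tree_src /tree_tgt /=.
case: v a => // j a; case: v' b => // j' b _ _ + ww.
move: b; rewrite -{}ww {w'}; case: w a => // i a b _.
have ij : i./2 = j by move: a => /=; case: eqP => // _ [].
have ij' : i./2 = j' by move: b => /=; case: eqP => // _ [].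
have jj : j' = j by apply: val_inj; rewrite /= -ij -ij'.
subst j'; suff -> : a = b by [].
have c0 (c : 'I_(tree_mult (inl j : tree_vertex n)
                           (inl i : tree_vertex n.+1))) : c = 0%N :> nat.
  by case: c => c /=; rewrite ij eqxx; case: c.
by apply: val_inj; exact: etrans (c0 a) (esym (c0 b)).
Qed.

Lemma u_edge_min n (e : edge tree_bratteli n) :
  is_u (tree_src e) -> min_edge o e.
Proof.
move=> ue f fe; have [uf|cf] := boolP (is_u (tree_src f)).
  by rewrite (u_edge_inj uf ue fe); exact: elt_irr.
have ef : elt o e f.
  apply: ho => //=; move: ue cf.
  by case: (tree_src e) => // j; case: (tree_src f).
apply/negP => /(elt_trans (esym fe) fe ef); apply/negP; exact: elt_irr.
Qed.

Lemma u_path_X_min (x : path_space tree_bratteli) :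
  is_u (tree_src (x 0%N)) -> X_min o x.
Proof.
move=> x0 n; apply: u_edge_min.
elim: n => [//|n IH].
by rewrite -(path_edgeP x n : tree_tgt _ = tree_src _); exact: u_edge_tgt.
Qed.

End Tree.

Theorem theorem6p9 (R : realType) (o : edge_order tree_bratteli)
    (ho : left_to_right o tree_left) :
  [/\ X_max o = set0,
      homeomorphism setT (~` X_min o) (vershik o),
      exists C : set (path_space tree_bratteli),
        [/\ C !=set0, clopen C &
            compressible (tail_equiv tree_bratteli)
              (saturation (tail_equiv tree_bratteli) C)] &
      ~ exists mu : probability (borel (path_space tree_bratteli)) R,
          vershik_invariant o mu /\
          forall n (e : fin_path tree_bratteli n),
            (0%R < mu (cylinder e))%E].
Proof.
have max0 := tree_X_max ho.
pose C : set (path_space tree_bratteli) := [set x | is_u (tree_src (x 0%N))].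
have Cmin : C `<=` X_min o by move=> x; exact: u_path_X_min.
have clC : clopen C :=
  @clopen_first_edge tree_bratteli (fun e => is_u (tree_src e)).
have [x0 x0u] := @path_from tree_bratteli (inl ord0 : tree_vertex 0).
have Cx0 : C x0 by rewrite /C /= (x0u : tree_src _ = _).
split=> //.
- by have := vershik_homeomorphism o; rewrite max0 setC0.
- exists C; split=> //; first by exists x0.
  by apply: (@vershik_compressible _ o) => //; case: clC.
move=> [mu [inv /(_ 0%N (path_prefix x0 0))]].
have mu0 : mu (cylinder (path_prefix x0 0)) = 0%E.
  apply: (invariant_X_min inv); first exact: cylinder_measurable.
  by move=> x xe; apply: Cmin; rewrite /C /= (xe 0%N isT).
by rewrite mu0 Order.POrderTheory.ltxx.
Qed.
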